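(* Let $(\boldsymbol{x}^*,\lambda^* )$ be a $\gamma$-Newton-stable real eigenpair (for some $\gamma>0$) of a symmetric real tensor $\mathcal{T}$ of order $m$ and dimension $n$. There exists an $\varepsilon=\varepsilon(\gamma)>0$ such that for any $\boldsymbol{x}_{(0)}\in S_{n-1}$ that satisfies $\|\boldsymbol{x}_{(0)}-\boldsymbol{x}^*\|<\varepsilon$, the sequence $\boldsymbol{x}_{(0)},\boldsymbol{x}_{(1)},\dots$ of orthogonal Newton correction method (O--NCM) iterates started at $\boldsymbol{x}_{(0)}$ converges to $\boldsymbol{x}^*$ at a quadratic rate.
   Context: $S_{n-1}=\{\boldsymbol{x}\in\mathbb{R}^n:\|\boldsymbol{x}\|=1\}$ is the Euclidean unit sphere and $I$ is the identity matrix. A tensor $\mathcal{T}\in\mathbb{R}^{n\times\cdots\times n}$ of order $m$ and dimension $n$ has entries $t_{i_1,\dots,i_m}$, $i_1,\dots,i_m\in\{1,\dots,n\}$; it is symmetric if its entries are invariant under all permutations of the $m$ indices. For $\boldsymbol{x}\in\mathbb{R}^n$: $\mu(\boldsymbol{x})=\mathcal{T}(\boldsymbol{x},\dots,\boldsymbol{x})=\sum_{i_1,\dots,i_m} t_{i_1,\dots,i_m}x_{i_1}\cdots x_{i_m}\in\mathbb{R}$; $\mathcal{T}(I,\boldsymbol{x},\dots,\boldsymbol{x})\in\mathbb{R}^n$ is the vector with $i$-th entry $\sum_{i_2,\dots,i_m}t_{i,i_2,\dots,i_m}x_{i_2}\cdots x_{i_m}$; $\mathcal{T}(I,I,\boldsymbol{x},\dots,\boldsymbol{x})\in\mathbb{R}^{n\times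 n}$ is the matrix with $(i,j)$ entry $\sum_{i_3,\dots,i_m}t_{i,j,i_3,\dots,i_m}x_{i_3}\cdots x_{i_m}$. A pair $(\boldsymbol{x}^*,\lambda^* )\in\mathbb{R}^n\times\mathbb{R}$ is a real eigenpair of $\mathcal{T}$ if $\mathcal{T}(I,\boldsymbol{x}^*,\dots,\boldsymbol{x}^* )=\lambda^*\boldsymbol{x}^*$ and $\|\boldsymbol{x}^*\|=1$. Define $\boldsymbol{g}(\boldsymbol{x})=\mathcal{T}(I,\boldsymbol{x},\dots,\boldsymbol{x})-\mu(\boldsymbol{x})\boldsymbol{x}$ and $H(\boldsymbol{x})=(m-1)\mathcal{T}(I,I,\boldsymbol{x},\dots,\boldsymbol{x})-\mu(\boldsymbol{x})I$. For $\boldsymbol{x}\in S_{n-1}$ let $U_{\boldsymbol{x}}\in\mathbb{R}^{n\times(n-1)}$ have orthonormal columns spanning the orthogonal complement of $\boldsymbol{x}$, and let $H_p(\boldsymbol{x})=U_{\boldsymbol{x}}^TH(\boldsymbol{x})U_{\boldsymbol{x}}$ (projected Hessian). For $\gamma>0$, an eigenpair $(\boldsymbol{x}^*,\lambda^* )$ is $\gamma$-Newton-stable if all eigenvalues of $H_p(\boldsymbol{x}^* )$ have absolute value at least $\gamma$. O--NCM: starting from $\boldsymbol{x}_{(0)}\in S_{n-1}$, iterate for $k=0,1,2,\dots$: $\boldsymbol{u}_{(k)}=-U_{\boldsymbol{x}_{(k)}}H_p(\boldsymbol{x}_{(k)})^{-1}U_{\boldsymbol{x}_{(k)}}^T\boldsymbol{g}(\boldsymbol{x}_{(k)})$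 and $\boldsymbol{x}_{(k+1)}=(\boldsymbol{x}_{(k)}+\boldsymbol{u}_{(k)})/\|\boldsymbol{x}_{(k)}+\boldsymbol{u}_{(k)}\|$ (the stopping criterion is ignored, so the sequence is infinite; the claim includes that the iterates are well defined). Convergence to $\boldsymbol{x}^*$ at a quadratic rate means $\boldsymbol{x}_{(k)}\to\boldsymbol{x}^*$ and there is a constant $C>0$ such that $\|\boldsymbol{x}^*-\boldsymbol{x}_{(k+1)}\|\le C\|\boldsymbol{x}^*-\boldsymbol{x}_{(k)}\|^2$ for all $k\ge 0$. *)

(* Defs.v *)
From mathcomp Require Import all_boot all_order all_algebra all_fingroup.
From mathcomp Require Import all_classical all_reals all_analysis.

Set Implicit Arguments.
Unset Strict Implicit.
Unset Printing Implicit Defensive.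

Import Order.TTheory GRing.Theory Num.Theory.
Import numFieldNormedType.Exports.

Local Open Scope classical_set_scope.
Local Open Scope ring_scope.

(* The norm `|x| of MathComp-Analysis on matrices is the sup norm. *)
Definition enorm (R : realType) (n : nat) (x : 'cV[R]_n) : R :=
  Num.sqrt (\sum_(i < n) x i 0 ^+ 2).

Definition on_sphere (R : realType) (n : nat) (x : 'cV[R]_n) : Prop :=
  enorm x = 1.

Definition tensor (R : realType) (m n : nat) : Type := m.-tuple 'I_n -> R.

Definition symmetric_tensor (R : realType) (m n : nat) (T : tensor R m n) :
    Prop :=
  forall (s : 'S_m) (t : m.-tuple 'I_n), T [tuple tnth t (s k) | k < m] = T t.

Definition monomial (R : realType) (m n : nat) (x : 'cV[R]_n)
    (t : m.-tuple 'I_n) : R :=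
  \prod_(k < m) x (tnth t k) 0.

(* mu, T1 and T2 are T(x,...,x), T(I,x,...,x) and T(I,I,x,...,x). *)
Definition mu (R : realType) (m n : nat) (T : tensor R m n) (x : 'cV[R]_n) : R :=
  \sum_(t : m.-tuple 'I_n) T t * monomial x t.

Definition T1 (R : realType) (m n : nat) (T : tensor R m.+1 n) (x : 'cV[R]_n) :
    'cV[R]_n :=
  \col_(i < n) \sum_(t : m.-tuple 'I_n) T [tuple of i :: t] * monomial x t.

Definition T2 (R : realType) (m n : nat) (T : tensor R m.+2 n) (x : 'cV[R]_n) :
    'M[R]_n :=
  \matrix_(i < n, j < n)
    \sum_(t : m.-tuple 'I_n) T [tuple of i :: j :: t] * monomial x t.

Definition eigenpair (R : realType) (m n : nat) (T : tensor R m.+1 n)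
    (x : 'cV[R]_n) (lambda : R) : Prop :=
  T1 T x = lambda *: x /\ enorm x = 1.

Definition g (R : realType) (m n : nat) (T : tensor R m.+1 n) (x : 'cV[R]_n) :
    'cV[R]_n :=
  T1 T x - mu T x *: x.

(* The order of T is m.+2, so "order minus one" is m.+1. *)
Definition H (R : realType) (m n : nat) (T : tensor R m.+2 n) (x : 'cV[R]_n) :
    'M[R]_n :=
  m.+1%:R *: T2 T x - (mu T x)%:M.

(* The columns of Ux are orthonormal and span the orthogonal complement of x:
   the row space of kermx x consists of all row vectors v with v *m x = 0. *)
Definition orthocompl_basis (R : realType) (n : nat) (x : 'cV[R]_n)
    (Ux : 'M[R]_(n, n.-1)) : Prop :=
  Ux^T *m Ux = 1%:M /\ (Ux^T == kermx x)%MS.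

Definition orthocompl_frame (R : realType) (n : nat)
    (U : 'cV[R]_n -> 'M[R]_(n, n.-1)) : Prop :=
  forall x : 'cV[R]_n, on_sphere x -> orthocompl_basis x (U x).

Definition Hp (R : realType) (m n : nat) (U : 'cV[R]_n -> 'M[R]_(n, n.-1))
    (T : tensor R m.+2 n) (x : 'cV[R]_n) : 'M[R]_(n.-1) :=
  (U x)^T *m H T x *m U x.

(* Hp U T x is real symmetric when T is symmetric, so quantifying over its real
   eigenvalues covers all of them. *)
Definition newton_stable (R : realType) (m n : nat)
    (U : 'cV[R]_n -> 'M[R]_(n, n.-1)) (T : tensor R m.+2 n) (gamma : R)
    (x : 'cV[R]_n) (lambda : R) : Prop :=
  eigenpair T x lambda /\
  forall a : R, eigenvalue (Hp U T x) a -> gamma <= `|a|.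

Definition oncm_correction (R : realType) (m n : nat)
    (U : 'cV[R]_n -> 'M[R]_(n, n.-1)) (T : tensor R m.+2 n) (x : 'cV[R]_n) :
    'cV[R]_n :=
  - (U x *m invmx (Hp U T x) *m (U x)^T *m g T x).

Definition oncm_step (R : realType) (m n : nat)
    (U : 'cV[R]_n -> 'M[R]_(n, n.-1)) (T : tensor R m.+2 n) (x : 'cV[R]_n) :
    'cV[R]_n :=
  let y := x + oncm_correction U T x in (enorm y)^-1 *: y.

Definition oncm (R : realType) (m n : nat)
    (U : 'cV[R]_n -> 'M[R]_(n, n.-1)) (T : tensor R m.+2 n) (x0 : 'cV[R]_n)
    (k : nat) : 'cV[R]_n :=
  iter k (oncm_step U T) x0.

(* invmx and ^-1 are total; this says that no inverse taken along the
   iteration is one of their default values. *)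
Definition oncm_well_defined (R : realType) (m n : nat)
    (U : 'cV[R]_n -> 'M[R]_(n, n.-1)) (T : tensor R m.+2 n) (x0 : 'cV[R]_n) :
    Prop :=
  forall k : nat,
    let xk := oncm U T x0 k in
    Hp U T xk \in unitmx /\ enorm (xk + oncm_correction U T xk) != 0.

(* The topology on 'cV[R]_n is that of the sup norm, hence the Euclidean one. *)
Definition quadratic_cvg (R : realType) (n : nat) (x : nat -> 'cV[R]_n)
    (l : 'cV[R]_n) : Prop :=
  x @ \oo --> l /\
  exists2 C : R, 0 < C &
    forall k : nat, enorm (l - x k.+1) <= C * enorm (l - x k) ^+ 2.

(* Main.v *)
Require Import Defs.
From mathcomp Require Import all_boot all_order all_algebra all_fingroup.
From mathcomp Require Import all_classical all_reals all_analysis.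
From mathcomp Require Import ring lra.

Set Implicit Arguments.
Unset Strict Implicit.
Unset Printing Implicit Defensive.

Import Order.TTheory GRing.Theory Num.Theory.
Import numFieldNormedType.Exports.

Local Open Scope ring_scope.

(** Let x be the current iterate, y the eigenvector and d = y - x, all on
    the unit sphere, and let P = 1 - x x^T be the projection onto the
    tangent space at x. For a frame matrix U at x one has U U^T = P, so the
    frame disappears from all estimates: the correction u is the tangent
    vector that solves P H(x) P u = - P g(x).

    Quadratic error. Symmetry of T gives the first-order expansion T1(y) =
    T1(x) + (m+1) T2(x) d + O(|d|^2) (mu_taylor). Substituting T1(y) =
    lambda y and projecting away the multiples of x turns g(x) + H(x) P d
    into P r with r = O(|d|^2), because mu(y) - mu(x) = O(|d|) and, on the
    sphere, x.d = - |d|^2 / 2. Hence P H(x) P (u - P d) = - P r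
    (newton_residualE), and an invertible P H P bounds u - P d, therefore x
    + u - y, by a multiple of |d|^2 (correction_error).

    Uniform invertibility. A symmetric matrix whose real eigenvalues have
    modulus at least gamma satisfies gamma |w| <= |A w|
    (sym_eigen_lower_bound), which gives |P H P v| >= gamma |v| on the
    tangent space at y. Since P H P is Lipschitz in the base point, the
    bound persists with gamma / 2 on the tangent space at x when x is near
    y (lower_bound_near).

    Every constant involved is computed from gamma and from bounds, over
    the whole sphere, of polynomial expressions in x, y and the entries of
    T, which is why one radius serves every stable eigenvector and every
    choice of frames. Normalising x + u costs a factor 2 (normalize_error);
    on a small enough ball the quadratic estimate also halves the error, so
    the iterates stay in the ball and converge geometrically. *)

(** * Euclidean norm and inner product *)

Lemma sum_sqr_ge0 (R : realType) (n : nat) (x : 'cV[R]_n) :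
  0 <= \sum_(i < n) x i 0 ^+ 2.
Proof. by apply: sumr_ge0 => i _; exact: sqr_ge0. Qed.

Lemma enorm_ge0 (R : realType) (n : nat) (x : 'cV[R]_n) : 0 <= enorm x.
Proof. exact: sqrtr_ge0. Qed.

Definition dot (R : realType) (n : nat) (x y : 'cV[R]_n) : R :=
  (x^T *m y) 0 0.

Lemma dotC (R : realType) (n : nat) (x y : 'cV[R]_n) : dot x y = dot y x.
Proof. by rewrite /dot -[in LHS](trmxK y) -trmx_mul mxE. Qed.

Lemma dotDr (R : realType) (n : nat) (x y z : 'cV[R]_n) :
  dot x (y + z) = dot x y + dot x z.
Proof. by rewrite /dot mulmxDr mxE. Qed.

Lemma dotZr (R : realType) (n : nat) (a : R) (x y : 'cV[R]_n) :
  dot x (a *: y) = a * dot x y.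
Proof. by rewrite /dot -scalemxAr mxE. Qed.

Lemma dotDl (R : realType) (n : nat) (x y z : 'cV[R]_n) :
  dot (x + y) z = dot x z + dot y z.
Proof. by rewrite dotC dotDr !(dotC z). Qed.

Lemma dotZl (R : realType) (n : nat) (a : R) (x y : 'cV[R]_n) :
  dot (a *: x) y = a * dot x y.
Proof. by rewrite dotC dotZr dotC. Qed.

Lemma dot_mulmx (R : realType) (p n : nat) (A : 'M[R]_(p, n)) x y :
  dot x (A *m y) = dot (A^T *m x) y.
Proof. by rewrite /dot trmx_mul trmxK mulmxA. Qed.

Lemma sqr_enorm (R : realType) (n : nat) (x : 'cV[R]_n) :
  enorm x ^+ 2 = dot x x.
Proof.
rewrite /dot sqr_sqrtr ?sum_sqr_ge0// mxE.
by apply: eq_bigr => i _; rewrite mxE expr2.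
Qed.

Lemma enorm0 (R : realType) (n : nat) : enorm (0 : 'cV[R]_n) = 0.
Proof.
by rewrite /enorm big1 ?sqrtr0// => i _; rewrite mxE expr0n.
Qed.

Lemma enorm_eq0 (R : realType) (n : nat) (x : 'cV[R]_n) :
  (enorm x == 0) = (x == 0).
Proof.
apply/idP/eqP => [|->]; last by rewrite enorm0.
rewrite sqrtr_eq0 => le0; apply/colP => i; rewrite mxE.
have /eqP : \sum_(i < n) x i 0 ^+ 2 = 0.
  by apply/eqP; rewrite eq_le le0 sum_sqr_ge0.
rewrite psumr_eq0; last by move=> j _; exact: sqr_ge0.
by move=> /allP/(_ i (mem_index_enum _))/=; rewrite sqrf_eq0 => /eqP.
Qed.

Lemma enormZ (R : realType) (n : nat) (a : R) (x : 'cV[R]_n) :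
  enorm (a *: x) = `|a| * enorm x.
Proof.
rewrite /enorm -sqrtr_sqr -sqrtrM ?sqr_ge0// mulr_sumr.
by congr Num.sqrt; apply: eq_bigr => i _; rewrite mxE exprMn.
Qed.

Lemma enormN (R : realType) (n : nat) (x : 'cV[R]_n) : enorm (- x) = enorm x.
Proof. by rewrite -scaleN1r enormZ normrN1 mul1r. Qed.

Lemma enormB (R : realType) (n : nat) (x y : 'cV[R]_n) :
  enorm (x - y) = enorm (y - x).
Proof. by rewrite -enormN opprB. Qed.

Lemma sqr_enormD (R : realType) (n : nat) (x y : 'cV[R]_n) :
  enorm (x + y) ^+ 2 = enorm x ^+ 2 + 2 * dot x y + enorm y ^+ 2.
Proof.
by rewrite !sqr_enorm dotDl !dotDr (dotC y x); ring.
Qed.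

Lemma cauchy_schwarz (R : realType) (n : nat) (x y : 'cV[R]_n) :
  dot x y <= enorm x * enorm y.
Proof.
have [->|x0] := eqVneq x 0; first by rewrite enorm0 /dot trmx0 mul0mx mul0r mxE.
have [->|y0] := eqVneq y 0; first by rewrite /dot mulmx0 enorm0 mulr0 mxE.
have xgt0 : 0 < enorm x by rewrite lt_def enorm_eq0 x0 enorm_ge0.
have ygt0 : 0 < enorm y by rewrite lt_def enorm_eq0 y0 enorm_ge0.
have := sqr_ge0 (enorm (enorm y *: x + (- enorm x) *: y)).
rewrite sqr_enormD !enormZ normrN !ger0_norm ?enorm_ge0//.
rewrite dotZl dotZr; set c := dot x y.
set a := enorm x in xgt0 *; set b := enorm y in ygt0 *.
have -> : (b * a) ^+ 2 + 2 * (b * (- a * c)) + (a * b) ^+ 2 =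
          (2 * (a * b)) * (a * b - c) by ring.
by rewrite pmulr_rge0 ?subr_ge0// !mulr_gt0.
Qed.

Lemma enormD (R : realType) (n : nat) (x y : 'cV[R]_n) :
  enorm (x + y) <= enorm x + enorm y.
Proof.
rewrite -(@ler_pXn2r _ 2) ?nnegrE ?addr_ge0 ?enorm_ge0//.
rewrite sqr_enormD sqrrD lerD2r lerD2l mulr_natl.
by rewrite lerMn2r cauchy_schwarz.
Qed.

Lemma coord_le_enorm (R : realType) (n : nat) (x : 'cV[R]_n) (i : 'I_n) :
  `|x i 0| <= enorm x.
Proof.
rewrite -sqrtr_sqr ler_wsqrtr// (bigD1 i)//= lerDl.
by apply: sumr_ge0 => j _; exact: sqr_ge0.
Qed.

Lemma enorm_le_sum (R : realType) (n : nat) (x : 'cV[R]_n) :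
  enorm x <= \sum_(i < n) `|x i 0|.
Proof.
have S0 : 0 <= \sum_(i < n) `|x i 0| by exact: sumr_ge0.
rewrite -(ler_pXn2r (n := 2)) ?nnegrE ?enorm_ge0//.
rewrite sqr_sqrtr ?sum_sqr_ge0// expr2 mulr_suml ler_sum// => i _.
rewrite -real_normK ?num_real// expr2 ler_wpM2l// (bigD1 i)//= lerDl.
exact: sumr_ge0.
Qed.

(** The sum of the moduli of the entries is a crude operator norm, but it
    inherits any bound that holds entry by entry. *)
Lemma enorm_mulmx_le (R : realType) (p n : nat) (A : 'M[R]_(p, n))
    (x : 'cV[R]_n) :
  enorm (A *m x) <= (\sum_(i < p) \sum_(j < n) `|A i j|) * enorm x.
Proof.
apply: (le_trans (enorm_le_sum _)); rewrite mulr_suml ler_sum// => i _.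
rewrite mxE mulr_suml; apply: (le_trans (ler_norm_sum _ _ _)).
by rewrite ler_sum// => j _; rewrite normrM ler_wpM2l// coord_le_enorm.
Qed.

(** * Lower bound for a symmetric matrix from its eigenvalues *)

(** Positivity of the form of B at w - B w / K, where K bounds the operator
    norm of B, yields |B w|^2 <= K (w . B w), and |w| is at most a multiple
    of |B w|. *)
Lemma psd_unit_coercive (R : realType) (n : nat) (B : 'M[R]_n) :
  B^T = B -> (forall w : 'cV[R]_n, 0 <= dot w (B *m w)) ->
  B \in unitmx ->
  exists2 c : R, 0 < c &
    forall w : 'cV[R]_n, c * enorm w ^+ 2 <= dot w (B *m w).
Proof.
move=> sB B0 uB.
have [K K0 leK] : exists2 K : R, 0 < K &
    forall w : 'cV[R]_n, enorm (B *m w) <= K * enorm w.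
  exists (\sum_i \sum_j `|B i j| + 1).
    by rewrite ltr_pwDr// sumr_ge0// => i _; exact: sumr_ge0.
  move=> w; apply: (le_trans (enorm_mulmx_le _ _)).
  by rewrite ler_wpM2r ?enorm_ge0// lerDl.
have [L L0 leL] : exists2 L : R, 0 < L &
    forall w : 'cV[R]_n, enorm w <= L * enorm (B *m w).
  exists (\sum_i \sum_j `|(invmx B) i j| + 1).
    by rewrite ltr_pwDr// sumr_ge0// => i _; exact: sumr_ge0.
  move=> w; rewrite -{1}(mulKmx uB w); apply: (le_trans (enorm_mulmx_le _ _)).
  by rewrite ler_wpM2r ?enorm_ge0// lerDl.
exists (K * L ^+ 2)^-1; first by rewrite invr_gt0 mulr_gt0// exprn_gt0.
move=> w; rewrite ler_pdivrMl ?mulr_gt0 ?exprn_gt0//.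
have : enorm w ^+ 2 <= L ^+ 2 * enorm (B *m w) ^+ 2.
  by rewrite -exprMn lerXn2r ?nnegrE ?mulr_ge0 ?enorm_ge0 ?(ltW L0).
move=> /le_trans; apply; rewrite [K * _]mulrC -[leRHS]mulrA.
rewrite ler_pM2l ?exprn_gt0//.
(* The step 1 / K is short enough for the quadratic term to be absorbed. *)
set b := B *m w; have := B0 (w - K^-1 *: b).
rewrite -scaleNr mulmxDr -scalemxAr !dotDl !dotDr !dotZl !dotZr -/b.
rewrite (dot_mulmx B w b) sB -/b -!sqr_enorm.
have : dot b (B *m b) <= K * enorm b ^+ 2.
  apply: (le_trans (cauchy_schwarz _ _)).
  by rewrite expr2 mulrCA ler_wpM2l ?enorm_ge0.
move: (dot w b) (dot b _) (enorm b ^+ 2) => p q e qle pge0.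
have : K^-1 * (K^-1 * q) <= K^-1 * e.
  by rewrite ler_pM2l ?invr_gt0// ler_pdivrMl.
move=> qle'; rewrite -ler_pdivrMl//; lra.
Qed.

(** Let s be the infimum of |A w|^2 / |w|^2. Then B = A^2 - s is positive
    semidefinite, and it is singular, since otherwise coercivity would
    raise the infimum. As B = (A - sqrt s) (A + sqrt s), one of sqrt s and
    - sqrt s is an eigenvalue of A. *)
Lemma sym_eigen_lower_bound (R : realType) (n : nat) (A : 'M[R]_n) (c : R) :
  A^T = A -> (forall a : R, eigenvalue A a -> c <= `|a|) ->
  forall w : 'cV[R]_n, c * enorm w <= enorm (A *m w).
Proof.
move=> sA eigA w0; rewrite leNgt; apply/negP => ltw0.
have w0gt0 : 0 < enorm w0.
  rewrite lt_def enorm_ge0 andbT; apply: contraTneq ltw0 => w00.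
  by rewrite w00 mulr0 -leNgt enorm_ge0.
pose S : set R :=
  [set t | forall w, t * enorm w ^+ 2 <= enorm (A *m w) ^+ 2]%classic.
have S0 : S 0 by move=> w; rewrite mul0r sqr_ge0.
pose r := enorm (A *m w0) / enorm w0.
have rltc : r < c by rewrite ltr_pdivrMr.
have r0 : 0 <= r by rewrite divr_ge0 ?enorm_ge0.
have ubS : ubound S (r ^+ 2).
  by move=> t /(_ w0); rewrite -ler_pdivlMr ?exprn_gt0// expr_div_n.
have hsS : has_sup S by split; [exists 0|exists (r ^+ 2)].
set s := sup S.
have s0 : 0 <= s by exact: (ub_le_sup (proj2 hsS)).
have sler : s <= r ^+ 2 by apply: ge_sup => //; exists 0.
have Ss : S s.
  move=> w; have [->|wn0] := eqVneq w 0.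
    by rewrite enorm0 expr0n mulr0 sqr_ge0.
  have wgt0 : 0 < enorm w ^+ 2.
    by rewrite exprn_gt0// lt_def enorm_eq0 wn0 enorm_ge0.
  rewrite -ler_pdivlMr//; apply: ge_sup; first by exists 0.
  by move=> t St; rewrite ler_pdivlMr.
pose B := A *m A - s%:M.
have EB w : dot w (B *m w) = enorm (A *m w) ^+ 2 - s * enorm w ^+ 2.
  rewrite mulmxBl mul_scalar_mx -scaleNr dotDr dotZr mulNr -mulmxA.
  by rewrite dot_mulmx sA -!sqr_enorm.
have sB : B^T = B by rewrite linearB/= trmx_mul sA tr_scalar_mx.
have B0 w : 0 <= dot w (B *m w) by rewrite EB subr_ge0; exact: Ss.
have [uB|nuB] := boolP (B \in unitmx).
  have [e e0 Be] := psd_unit_coercive sB B0 uB.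
  have /(ub_le_sup (proj2 hsS)) : S (s + e).
    by move=> w; have := Be w; rewrite EB lerBrDl mulrDl.
  by rewrite -/s gerDl leNgt e0.
have Efac : B = (A - (Num.sqrt s)%:M) *m (A - (- Num.sqrt s)%:M).
  rewrite mulmxBl !mulmxBr !mul_scalar_mx !mul_mx_scalar scale_scalar_mx.
  rewrite mulrN -expr2 sqr_sqrtr// scaleNr !raddfN/= opprK.
  by rewrite [in RHS]opprK opprD addrA addrK.
have eig a : (A - a%:M) \notin unitmx -> eigenvalue A a.
  by rewrite /eigenvalue /eigenspace kermx_eq0 row_free_unit.
have /orP : ((A - (Num.sqrt s)%:M) \notin unitmx)
          || ((A - (- Num.sqrt s)%:M) \notin unitmx).
  by rewrite -negb_and -unitmx_mul -Efac.
have ltc : `|Num.sqrt s| < c.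
  rewrite ger0_norm ?sqrtr_ge0//; apply: le_lt_trans rltc.
  by rewrite -(ger0_norm r0) -sqrtr_sqr ler_wsqrtr.
by case=> /eig/eigA; rewrite ?normrN leNgt ltc.
Qed.

(** * Slices of a symmetric tensor *)

(** Fixing the first index lowers the order by one; T(I, x, ..., x) and
    T(I, I, x, ..., x) are the values of mu on the slices, so facts on mu
    can be proved by induction on the order. *)
Definition slice (R : realType) (m n : nat) (T : tensor R m.+1 n) (i : 'I_n) :
    tensor R m n :=
  fun t => T [tuple of i :: t].

(** A permutation of the remaining indices extends to one of all the
    indices that fixes the first. *)
Lemma symmetric_slice (R : realType) (m n : nat) (T : tensor R m.+1 n)
    (i : 'I_n) :
  symmetric_tensor T -> symmetric_tensor (slice T i).
Proof.
move=> symT s t; rewrite /slice -[RHS](symT (lift_perm 0 0 s)).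
congr T; apply: eq_from_tnth => k; rewrite tnth_mktuple.
case: (unliftP 0 k) => [j|] ->.
  by rewrite lift_perm_lift !tnthS tnth_mktuple.
by rewrite lift_perm_id !tnth0.
Qed.

Lemma sliceC (R : realType) (m n : nat) (T : tensor R m.+2 n) (i j : 'I_n) :
  symmetric_tensor T -> slice (slice T i) j = slice (slice T j) i.
Proof.
move=> symT; apply/funext => t; rewrite /slice -[RHS](symT (tperm 0 1)).
congr T; apply: eq_from_tnth => k; rewrite tnth_mktuple.
have [->|k0] := eqVneq k 0; first by rewrite tpermL.
have [->|k1] := eqVneq k 1; first by rewrite tpermR.
rewrite tpermD// 1?eq_sym//.
case: (unliftP 0 k) k0 k1 => [l|->]; last by rewrite eqxx.
move=> -> _; case: (unliftP 0 l) => [l'|] ->; last by rewrite eqE.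
by rewrite !tnthS.
Qed.

Lemma big_tupleS (R : realType) (m n : nat) (F : m.+1.-tuple 'I_n -> R) :
  \sum_t F t = \sum_(i < n) \sum_(t : m.-tuple 'I_n) F [tuple of i :: t].
Proof.
rewrite pair_big/=.
rewrite (reindex (fun p : 'I_n * m.-tuple 'I_n => [tuple of p.1 :: p.2]))//=.
exists (fun t => (thead t, [tuple of behead t])) => [[i t] _|t _]/=.
  by rewrite theadE; congr (_, _); apply: val_inj.
by rewrite -tuple_eta.
Qed.

Lemma monomial_cons (R : realType) (m n : nat) (x : 'cV[R]_n) (i : 'I_n)
    (t : m.-tuple 'I_n) :
  monomial x [tuple of i :: t] = x i 0 * monomial x t.
Proof.
rewrite /monomial big_ord_recl tnth0; congr (_ * _).
by apply: eq_bigr => k _; rewrite tnthS.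
Qed.

Lemma mu_rec (R : realType) (m n : nat) (T : tensor R m.+1 n) (x : 'cV[R]_n) :
  mu T x = \sum_(i < n) x i 0 * mu (slice T i) x.
Proof.
rewrite /mu big_tupleS; apply: eq_bigr => i _; rewrite mulr_sumr.
by apply: eq_bigr => t _; rewrite monomial_cons mulrCA.
Qed.

Lemma T1E (R : realType) (m n : nat) (T : tensor R m.+1 n) (x : 'cV[R]_n) i :
  T1 T x i 0 = mu (slice T i) x.
Proof. by rewrite mxE. Qed.

Lemma T2E (R : realType) (m n : nat) (T : tensor R m.+2 n) (x : 'cV[R]_n) i j :
  T2 T x i j = mu (slice (slice T i) j) x.
Proof.
by rewrite mxE.
Qed.

(** * Uniform orders of vanishing on the sphere *)

(** The relation e(x, y) = O(|y - x|^p), with a constant valid on the whole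
    sphere; p = 0 expresses boundedness, and p = 1 for a difference of
    values expresses the Lipschitz property. *)
Definition sphO (R : realType) (n p : nat) (e : 'cV[R]_n -> 'cV[R]_n -> R) :
    Prop :=
  exists2 K : R, 0 <= K & forall x y : 'cV[R]_n, on_sphere x -> on_sphere y ->
    `|e x y| <= K * enorm (y - x) ^+ p.

Lemma eq_sphO (R : realType) (n p : nat) (e f : 'cV[R]_n -> 'cV[R]_n -> R) :
  (forall x y, on_sphere x -> on_sphere y -> e x y = f x y) ->
  sphO p e -> sphO p f.
Proof.
by move=> ef [K K0 leK]; exists K => // x y xS yS; rewrite -ef// leK.
Qed.

Lemma sphO_cst (R : realType) (n : nat) (c : R) :
  @sphO R n 0 (fun _ _ => c).
Proof. by exists `|c| => // x y _ _; rewrite expr0 mulr1. Qed.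

Lemma sphO_swap (R : realType) (n p : nat) (e : 'cV[R]_n -> 'cV[R]_n -> R) :
  sphO p e -> sphO p (fun x y => e y x).
Proof.
by move=> [K K0 leK]; exists K => // x y xS yS; rewrite enormB leK.
Qed.

Lemma sphO_coord (R : realType) (n : nat) (i : 'I_n) :
  @sphO R n 0 (fun x _ => x i 0).
Proof.
exists 1 => // x y xS _; rewrite mul1r expr0 -xS; exact: coord_le_enorm.
Qed.

Lemma sphO_coordB (R : realType) (n : nat) (i : 'I_n) :
  @sphO R n 1 (fun x y => y i 0 - x i 0).
Proof.
exists 1 => // x y _ _; have := coord_le_enorm (y - x) i.
by rewrite mul1r expr1 !mxE.
Qed.

Lemma sphOD (R : realType) (n p : nat) (e f : 'cV[R]_n -> 'cV[R]_n -> R) :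
  sphO p e -> sphO p f -> sphO p (fun x y => e x y + f x y).
Proof.
move=> [K K0 leK] [L L0 leL]; exists (K + L); first exact: addr_ge0.
move=> x y xS yS; rewrite mulrDl (le_trans (ler_normD _ _))//.
by rewrite lerD ?leK ?leL.
Qed.

Lemma sphOM (R : realType) (n p q : nat) (e f : 'cV[R]_n -> 'cV[R]_n -> R) :
  sphO p e -> sphO q f -> sphO (p + q) (fun x y => e x y * f x y).
Proof.
move=> [K K0 leK] [L L0 leL]; exists (K * L); first exact: mulr_ge0.
by move=> x y xS yS; rewrite normrM exprD mulrACA ler_pM ?leK ?leL.
Qed.

Lemma sphON (R : realType) (n p : nat) (e : 'cV[R]_n -> 'cV[R]_n -> R) :
  sphO p e -> sphO p (fun x y => - e x y).
Proof. by move=> [K K0 leK]; exists K => // x y xS yS; rewrite normrN leK. Qed.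

Lemma sphO_sum (R : realType) (n p : nat) (I : Type) (r : seq I)
    (e : I -> 'cV[R]_n -> 'cV[R]_n -> R) :
  (forall i, sphO p (e i)) -> sphO p (fun x y => \sum_(i <- r) e i x y).
Proof.
move=> eO; elim: r => [|i r IHr].
  by exists 0 => // x y _ _; rewrite big_nil normr0 mul0r.
by apply: eq_sphO (sphOD (eO i) IHr) => x y _ _; rewrite big_cons.
Qed.

(** * First-order expansion of a symmetric form *)

Lemma mu_bounded (R : realType) (k n : nat) (T : tensor R k n) :
  sphO 0 (fun x _ => mu T x).
Proof.
elim: k T => [|k IHk] T.
  apply: eq_sphO (sphO_cst n (\sum_(t : 0.-tuple 'I_n) T t)) => x y _ _.
  by apply: eq_bigr => t _; rewrite /monomial big_ord0 mulr1.
apply: (@eq_sphO _ _ _ (fun x _ => \sum_i x i 0 * mu (slice T i) x)).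
  by move=> x y _ _; rewrite -mu_rec.
by apply: sphO_sum => i; apply: (sphOM (sphO_coord R i) (IHk _)).
Qed.

Lemma mu_lipschitz (R : realType) (k n : nat) (T : tensor R k n) :
  sphO 1 (fun x y => mu T y - mu T x).
Proof.
elim: k T => [|k IHk] T.
  exists 0 => // x y _ _; rewrite mul0r /mu -sumrB big1 ?normr0// => t _.
  by rewrite /monomial !big_ord0 subrr.
apply: (@eq_sphO _ _ _ (fun x y => \sum_i
    ((y i 0 - x i 0) * mu (slice T i) y +
     x i 0 * (mu (slice T i) y - mu (slice T i) x)))).
  move=> x y _ _; rewrite !mu_rec -sumrB; apply: eq_bigr => i _; ring.
apply: sphO_sum => i; apply: sphOD.
  by apply: (sphOM (sphO_coordB R i)); apply: sphO_swap; exact: mu_bounded.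
exact: (sphOM (sphO_coord R i) (IHk _)).
Qed.

(** Expand one index: mu T is the sum of the x_i mu(T_i), so mu T y - mu T
    x splits into the d_i mu(T_i)(y), with d = y - x, and the x_i times the
    increments of the mu(T_i). By induction the latter contribute k times
    the linear term, because T_ij = T_ji allows the two sums to be
    exchanged; the former contribute it once more, up to d_i times an
    increment. *)
Lemma mu_taylor (R : realType) (k n : nat) (T : tensor R k.+1 n) :
  symmetric_tensor T ->
  sphO 2 (fun x y => mu T y - mu T x -
    k.+1%:R * \sum_i (y i 0 - x i 0) * mu (slice T i) x).
Proof.
elim: k T => [|k IHk] T symT.
  exists 0 => // x y _ _; rewrite mul0r mul1r !(mu_rec T) -!sumrB big1 ?normr0//.
  move=> i _; have -> : mu (slice T i) y = mu (slice T i) x.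
    by apply: eq_bigr => t _; rewrite /monomial !big_ord0.
  by ring.
apply: (@eq_sphO _ _ _ (fun x y => \sum_i
    ((y i 0 - x i 0) * (mu (slice T i) y - mu (slice T i) x) +
     x i 0 * (mu (slice T i) y - mu (slice T i) x -
     k.+1%:R * \sum_j (y j 0 - x j 0) * mu (slice (slice T i) j) x)))).
  move=> x y _ _.
  have swap : \sum_i x i 0 *
        (\sum_j (y j 0 - x j 0) * mu (slice (slice T i) j) x) =
      \sum_j (y j 0 - x j 0) * mu (slice T j) x.
    transitivity (\sum_i \sum_j (y j 0 - x j 0) *
        (x i 0 * mu (slice (slice T j) i) x)).
      apply: eq_bigr => i _; rewrite mulr_sumr; apply: eq_bigr => j _.
      by rewrite sliceC// mulrCA.
    by rewrite exchange_big; apply: eq_bigr => j _; rewrite -mulr_sumr -mu_rec.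
  (* The coefficient k + 2 is the inductive k + 1 plus the direct term. *)
  rewrite -(natr1 k.+1) mulrDl mul1r -[X in k.+1%:R * X + _]swap.
  rewrite (mu_rec T x) (mu_rec T y) mulr_sumr -big_split/= -!sumrB.
  by apply: eq_bigr => i _; ring.
apply: sphO_sum => i; apply: sphOD.
  exact: (sphOM (sphO_coordB R i) (mu_lipschitz _)).
exact: (sphOM (sphO_coord R i) (IHk _ (symmetric_slice i symT))).
Qed.

(** * Matrix-valued expressions *)

Definition mxO (R : realType) (n p a b : nat)
    (E : 'cV[R]_n -> 'cV[R]_n -> 'M[R]_(a, b)) : Prop :=
  forall i j, sphO p (fun x y => E x y i j).

Lemma mxOD (R : realType) (n p a b : nat)
    (E F : 'cV[R]_n -> 'cV[R]_n -> 'M[R]_(a, b)) :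
  mxO p E -> mxO p F -> mxO p (fun x y => E x y + F x y).
Proof.
move=> EO FO i j.
by apply: eq_sphO (sphOD (EO i j) (FO i j)) => x y _ _; rewrite mxE.
Qed.

Lemma mxON (R : realType) (n p a b : nat)
    (E : 'cV[R]_n -> 'cV[R]_n -> 'M[R]_(a, b)) :
  mxO p E -> mxO p (fun x y => - E x y).
Proof.
by move=> EO i j; apply: eq_sphO (sphON (EO i j)) => x y _ _; rewrite mxE.
Qed.

Lemma mxOZ (R : realType) (n p q a b : nat)
    (e : 'cV[R]_n -> 'cV[R]_n -> R)
    (E : 'cV[R]_n -> 'cV[R]_n -> 'M[R]_(a, b)) :
  sphO p e -> mxO q E -> mxO (p + q) (fun x y => e x y *: E x y).
Proof.
by move=> eO EO i j; apply: eq_sphO (sphOM eO (EO i j)) => x y _ _; rewrite mxE.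
Qed.

Lemma mxOM (R : realType) (n p q a b c : nat)
    (E : 'cV[R]_n -> 'cV[R]_n -> 'M[R]_(a, b))
    (F : 'cV[R]_n -> 'cV[R]_n -> 'M[R]_(b, c)) :
  mxO p E -> mxO q F -> mxO (p + q) (fun x y => E x y *m F x y).
Proof.
move=> EO FO i j.
apply: (@eq_sphO _ _ _ (fun x y => \sum_k E x y i k * F x y k j)).
  by move=> x y _ _; rewrite mxE.
by apply: sphO_sum => k; apply: sphOM.
Qed.

Lemma mxO_tr (R : realType) (n p a b : nat)
    (E : 'cV[R]_n -> 'cV[R]_n -> 'M[R]_(a, b)) :
  mxO p E -> mxO p (fun x y => (E x y)^T).
Proof.
by move=> EO i j; apply: eq_sphO (EO j i) => x y _ _; rewrite mxE.
Qed.

Lemma eq_mxO (R : realType) (n p a b : nat)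
    (E F : 'cV[R]_n -> 'cV[R]_n -> 'M[R]_(a, b)) :
  (forall x y, on_sphere x -> on_sphere y -> E x y = F x y) ->
  mxO p E -> mxO p F.
Proof.
by move=> EF EO i j; apply: eq_sphO (EO i j) => x y xS yS; rewrite EF.
Qed.

Lemma mxO_id (R : realType) (n : nat) :
  mxO 0 (fun x _ : 'cV[R]_n => x).
Proof. by move=> i j; rewrite (ord1 j); exact: sphO_coord. Qed.

Lemma mxO_idB (R : realType) (n : nat) :
  mxO 1 (fun x y : 'cV[R]_n => y - x).
Proof.
move=> i j; rewrite (ord1 j); apply: eq_sphO (sphO_coordB R i) => x y _ _.
by rewrite !mxE.
Qed.

Lemma sphO_sum_norm (R : realType) (n p : nat) (I : finType)
    (e : I -> 'cV[R]_n -> 'cV[R]_n -> R) :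
  (forall i, sphO p (e i)) ->
  sphO p (fun x y => \sum_i `|e i x y|).
Proof.
move=> eO; apply: sphO_sum => i; have [K K0 leK] := eO i.
by exists K => // x y xS yS; rewrite normr_id leK.
Qed.

Lemma mxO_enorm (R : realType) (n p a b : nat)
    (E : 'cV[R]_n -> 'cV[R]_n -> 'M[R]_(a, b)) :
  mxO p E -> exists2 K : R, 0 <= K &
    forall x y : 'cV[R]_n, on_sphere x -> on_sphere y ->
    forall v : 'cV[R]_b,
      enorm (E x y *m v) <= K * enorm (y - x) ^+ p * enorm v.
Proof.
move=> EO.
have [K K0 leK] : sphO p (fun x y => \sum_i \sum_j `|E x y i j|).
  by apply: sphO_sum => i; exact: (sphO_sum_norm (EO i)).
exists K => // x y xS yS v; apply: (le_trans (enorm_mulmx_le _ _)).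
rewrite ler_wpM2r ?enorm_ge0//; apply: le_trans (leK x y xS yS).
exact: ler_norm.
Qed.

Lemma mxO_enorm_vec (R : realType) (n p a : nat)
    (E : 'cV[R]_n -> 'cV[R]_n -> 'cV[R]_a) :
  mxO p E -> exists2 K : R, 0 <= K &
    forall x y : 'cV[R]_n, on_sphere x -> on_sphere y ->
      enorm (E x y) <= K * enorm (y - x) ^+ p.
Proof.
move=> /mxO_enorm[K K0 leK]; exists K => // x y xS yS.
have := leK x y xS yS 1%:M; rewrite mulmx1.
by rewrite [enorm 1%:M]/enorm big_ord1 mxE expr1n sqrtr1 mulr1.
Qed.

Lemma lipschitz_mulmx (R : realType) (n a b c : nat)
    (E : 'cV[R]_n -> 'M[R]_(a, b)) (F : 'cV[R]_n -> 'M[R]_(b, c)) :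
  mxO 0 (fun x _ => E x) -> mxO 1 (fun x y => E y - E x) ->
  mxO 0 (fun x _ => F x) -> mxO 1 (fun x y => F y - F x) ->
  mxO 1 (fun x y => E y *m F y - E x *m F x).
Proof.
move=> E0 E1 F0 F1.
apply: (@eq_mxO _ _ _ _ _ (fun x y =>
  (E y - E x) *m F y + E x *m (F y - F x))).
  by move=> x y _ _; rewrite mulmxBl mulmxBr addrA subrK.
apply: mxOD; last exact: (mxOM E0 F1).
by apply: (mxOM E1) => i j; apply: sphO_swap; exact: F0.
Qed.

(** * Tangent projection and projected Hessian *)

Definition tproj (R : realType) (n : nat) (x : 'cV[R]_n) : 'M[R]_n :=
  1%:M - x *m x^T.

(** The n by n compression of the Hessian. It is defined from x alone and
    is polynomial in x, whereas the frame matrix need not even be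
    continuous in x. *)
Definition projH (R : realType) (m n : nat) (T : tensor R m.+2 n)
    (x : 'cV[R]_n) : 'M[R]_n :=
  tproj x *m H T x *m tproj x.

Lemma sphere_dotxx (R : realType) (n : nat) (x : 'cV[R]_n) :
  on_sphere x -> x^T *m x = 1%:M.
Proof.
move=> xS; apply/matrixP => i j; rewrite !ord1 -/(dot x x) -sqr_enorm xS.
by rewrite expr1n mxE.
Qed.

Lemma tproj_tr (R : realType) (n : nat) (x : 'cV[R]_n) :
  (tproj x)^T = tproj x.
Proof. by rewrite linearB/= trmx1 trmx_mul trmxK. Qed.

Lemma tproj_self (R : realType) (n : nat) (x : 'cV[R]_n) :
  on_sphere x -> tproj x *m x = 0.
Proof.
by move=> xS; rewrite mulmxBl mul1mx -mulmxA sphere_dotxx// mulmx1 subrr.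
Qed.

Lemma tprojE (R : realType) (n : nat) (x v : 'cV[R]_n) :
  tproj x *m v = v - dot x v *: x.
Proof.
rewrite mulmxBl mul1mx -mulmxA; congr (_ - _).
by rewrite [x^T *m v]mx11_scalar mul_mx_scalar.
Qed.

Lemma tproj_idem (R : realType) (n : nat) (x : 'cV[R]_n) :
  on_sphere x -> tproj x *m tproj x = tproj x.
Proof.
move=> xS; rewrite {2}/tproj mulmxBr mulmx1 mulmxA tproj_self//.
by rewrite mul0mx subr0.
Qed.

Lemma enorm_tproj_le (R : realType) (n : nat) (x v : 'cV[R]_n) :
  on_sphere x -> enorm (tproj x *m v) <= enorm v.
Proof.
move=> xS; have v0 := enorm_ge0 v.
have : enorm (tproj x *m v) ^+ 2 <= enorm (tproj x *m v) * enorm v.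
  apply: le_trans (cauchy_schwarz _ _).
  by rewrite sqr_enorm dot_mulmx tproj_tr mulmxA tproj_idem.
rewrite expr2; have [->//|P0] := eqVneq (enorm (tproj x *m v)) 0.
by rewrite ler_pM2l// lt_def P0 enorm_ge0.
Qed.

Lemma isometry_enorm (R : realType) (p n : nat) (V : 'M[R]_(n, p))
    (w : 'cV[R]_p) :
  V^T *m V = 1%:M -> enorm (V *m w) = enorm w.
Proof.
move=> VV; apply/eqP; rewrite -(@eqrXn2 _ 2) ?enorm_ge0// !sqr_enorm.
by rewrite dot_mulmx mulmxA VV mul1mx.
Qed.

Lemma orthocompl_basis_self (R : realType) (n : nat) (x : 'cV[R]_n)
    (V : 'M[R]_(n, n.-1)) :
  orthocompl_basis x V -> V^T *m x = 0.
Proof. by move=> [_ /andP[sub _]]; apply/sub_kermxP. Qed.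

(** P vanishes on x, so its rows are combinations of the rows of V^T,
    whereas P V = V; orthonormality of the columns of V then identifies V
    V^T with P. *)
Lemma orthocompl_basis_proj (R : realType) (n : nat) (x : 'cV[R]_n)
    (V : 'M[R]_(n, n.-1)) :
  on_sphere x -> orthocompl_basis x V -> V *m V^T = tproj x.
Proof.
move=> xS bV; have Vx := orthocompl_basis_self bV.
have xV : x^T *m V = 0 by rewrite -[LHS]trmxK trmx_mul trmxK Vx trmx0.
case: (bV) => VV /andP[_ sub].
have /submxP[D PD] : (tproj x <= V^T)%MS.
  by apply: submx_trans sub; apply/sub_kermxP; exact: tproj_self.
have PV : tproj x *m V = V by rewrite mulmxBl mul1mx -mulmxA xV mulmx0 subr0.
by rewrite -{1}PV PD -(mulmxA D) VV mulmx1.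
Qed.

Lemma Hp_projH (R : realType) (m n : nat) (U : 'cV[R]_n -> 'M[R]_(n, n.-1))
    (T : tensor R m.+2 n) (x : 'cV[R]_n) :
  on_sphere x -> orthocompl_basis x (U x) ->
  projH T x = U x *m Hp U T x *m (U x)^T.
Proof.
by move=> xS bU; rewrite /projH -(orthocompl_basis_proj xS bU) /Hp !mulmxA.
Qed.

Lemma H_sym (R : realType) (m n : nat) (T : tensor R m.+2 n) (x : 'cV[R]_n) :
  symmetric_tensor T -> (H T x)^T = H T x.
Proof.
move=> symT; rewrite linearB/= tr_scalar_mx linearZ/=; congr (_ *: _ - _).
by apply/matrixP => i j; rewrite mxE !T2E sliceC.
Qed.

(** U is an isometry onto the tangent space, so the bound for the small
    matrix Hp transfers to projH. *)
Lemma newton_stable_lower_bound (R : realType) (m n : nat)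
    (U : 'cV[R]_n -> 'M[R]_(n, n.-1)) (T : tensor R m.+2 n) (gamma : R)
    (x : 'cV[R]_n) (lambda : R) :
  symmetric_tensor T -> orthocompl_basis x (U x) ->
  newton_stable U T gamma x lambda ->
  forall v, gamma * enorm (tproj x *m v) <= enorm (projH T x *m v).
Proof.
move=> symT bU [[_ xS] stab] v; case: (bU) => UU _.
rewrite (Hp_projH T xS bU) -(orthocompl_basis_proj xS bU).
rewrite -(mulmxA (U x) (U x)^T) -(mulmxA (U x *m Hp U T x)).
rewrite -(mulmxA (U x) (Hp U T x)).
rewrite !(isometry_enorm _ UU); apply: sym_eigen_lower_bound => //.
by rewrite /Hp !trmx_mul trmxK H_sym// mulmxA.
Qed.

(** * Lipschitz bounds for the projected Hessian *)

Lemma H_entry (R : realType) (m n : nat) (T : tensor R m.+2 n) (x : 'cV[R]_n)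
    (i j : 'I_n) :
  H T x i j =
  m.+1%:R * mu (slice (slice T i) j) x - (i == j)%:R * mu T x.
Proof. by rewrite !mxE [X in _ = _ - X]mulr_natl. Qed.

Lemma H_bounded (R : realType) (m n : nat) (T : tensor R m.+2 n) :
  mxO 0 (fun x _ => H T x).
Proof.
move=> i j; apply: (@eq_sphO _ _ _ (fun x _ =>
  m.+1%:R * mu (slice (slice T i) j) x + - ((i == j)%:R * mu T x))).
  by move=> x y _ _; rewrite H_entry.
apply: sphOD; first exact: (sphOM (sphO_cst n m.+1%:R) (mu_bounded _)).
exact: (sphON (sphOM (sphO_cst n _) (mu_bounded T))).
Qed.

Lemma H_lipschitz (R : realType) (m n : nat) (T : tensor R m.+2 n) :
  mxO 1 (fun x y => H T y - H T x).
Proof.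
move=> i j; apply: (@eq_sphO _ _ _ (fun x y =>
  m.+1%:R * (mu (slice (slice T i) j) y - mu (slice (slice T i) j) x) +
  - (i == j)%:R * (mu T y - mu T x))).
  move=> x y _ _; rewrite [RHS]mxE [X in _ = _ + X]mxE !H_entry; ring.
apply: sphOD; first exact: (sphOM (sphO_cst n m.+1%:R) (mu_lipschitz _)).
exact: (sphOM (sphO_cst n _) (mu_lipschitz T)).
Qed.

Lemma tproj_bounded (R : realType) (n : nat) :
  mxO 0 (fun x _ : 'cV[R]_n => tproj x).
Proof.
apply: mxOD; first by move=> i j; exact: sphO_cst.
exact: (mxON (mxOM (@mxO_id R n) (mxO_tr (@mxO_id R n)))).
Qed.

Lemma tproj_lipschitz (R : realType) (n : nat) :
  mxO 1 (fun x y : 'cV[R]_n => tproj y - tproj x).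
Proof.
apply: (@eq_mxO _ _ _ _ _ (fun x y => - (y *m y^T - x *m x^T))).
  by move=> x y _ _; rewrite /tproj opprB [in RHS]opprB [RHS]addrC addrA subrK.
apply: mxON; apply: (@lipschitz_mulmx _ _ _ _ _ id trmx).
- exact: mxO_id.
- exact: mxO_idB.
- exact: (mxO_tr (@mxO_id R n)).
- by apply: (eq_mxO _ (mxO_tr (@mxO_idB R n))) => x y _ _; rewrite linearB.
Qed.

Lemma projH_lipschitz (R : realType) (m n : nat) (T : tensor R m.+2 n) :
  mxO 1 (fun x y => projH T y - projH T x).
Proof.
apply: lipschitz_mulmx; [|apply: lipschitz_mulmx| |]; do
  ?[exact: tproj_bounded | exact: tproj_lipschitz | exact: H_bounded
   |exact: H_lipschitz].
exact: (mxOM (@tproj_bounded R n) (H_bounded T)).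
Qed.

(** * Residual of the Newton equation *)

(** On the sphere, 2 x.(y - x) = - |y - x|^2: the chord is tangent to the
    sphere up to second order. *)
Lemma sphere_dot_diff (R : realType) (n : nat) :
  sphO 2 (fun x y : 'cV[R]_n => dot x (y - x)).
Proof.
exists 2^-1; first by rewrite invr_ge0.
move=> x y xS yS; have := sqr_enormD x (y - x).
rewrite addrC subrK xS yS expr1n => Exy.
have -> : dot x (y - x) = - (2^-1 * enorm (y - x) ^+ 2).
  by move: Exy; lra.
by rewrite normrN ger0_norm// mulr_ge0// ?invr_ge0// sqr_ge0.
Qed.

Definition T1rem (R : realType) (m n : nat) (T : tensor R m.+2 n)
    (x y : 'cV[R]_n) : 'cV[R]_n :=
  T1 T y - T1 T x - m.+1%:R *: (T2 T x *m (y - x)).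

Lemma T1rem_quadratic (R : realType) (m n : nat) (T : tensor R m.+2 n) :
  symmetric_tensor T -> mxO 2 (T1rem T).
Proof.
move=> symT i j; rewrite (ord1 j).
apply: eq_sphO (mu_taylor (symmetric_slice i symT)) => x y _ _.
rewrite !mxE; congr (_ - _ * _); apply: eq_bigr => k _.
by rewrite T2E !mxE mulrC.
Qed.

(** The three second-order errors of the Newton equation: the change of the
    multiplier mu, the remainder of the expansion of T1, and the radial
    component of the chord y - x. *)
Definition newton_residual (R : realType) (m n : nat) (T : tensor R m.+2 n)
    (x y : 'cV[R]_n) : 'cV[R]_n :=
  (mu T y - mu T x) *: (y - x) - T1rem T x y - dot x (y - x) *: (H T x *m x).

Lemma newton_residual_quadratic (R : realType) (m n : nat)
    (T : tensor R m.+2 n) :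
  symmetric_tensor T -> mxO 2 (newton_residual T).
Proof.
move=> symT; apply: mxOD; first apply: mxOD.
- exact: (mxOZ (mu_lipschitz T) (@mxO_idB R n)).
- exact: (mxON (T1rem_quadratic symT)).
- apply: mxON; apply: (mxOZ (@sphere_dot_diff R n)).
  exact: (mxOM (H_bounded T) (@mxO_id R n)).
Qed.

Lemma mu_eigenpair (R : realType) (m n : nat) (T : tensor R m.+1 n)
    (x : 'cV[R]_n) (lambda : R) :
  eigenpair T x lambda -> mu T x = lambda.
Proof.
move=> [eT xS]; have -> : mu T x = dot x (T1 T x).
  by rewrite mu_rec /dot mxE; apply: eq_bigr => i _; rewrite T1E mxE.
by rewrite eT dotZr -sqr_enorm xS expr1n mulr1.
Qed.

(** Replacing T1(x) by its expansion around x towards y makes the T2 terms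
    cancel against H; what remains besides the residual is a multiple of x,
    which the projection kills. *)
Lemma newton_residualE (R : realType) (m n : nat) (T : tensor R m.+2 n)
    (x y : 'cV[R]_n) (lambda : R) :
  on_sphere x -> eigenpair T y lambda ->
  tproj x *m (g T x + H T x *m (tproj x *m (y - x))) =
  tproj x *m newton_residual T x y.
Proof.
move=> xS eT; have Emu := mu_eigenpair eT; case: eT => eT _.
have -> : g T x + H T x *m (tproj x *m (y - x)) =
    newton_residual T x y + (mu T y - mu T x) *: x.
  rewrite tprojE mulmxBr -scalemxAr /newton_residual /T1rem eT /g Emu.
  rewrite {1}/H mulmxBl -scalemxAl mul_scalar_mx.
  move: (T2 T x *m _) (dot _ _ *: _) (T1 T x) => a b c.
  rewrite !scalerBr !scalerBl.
  apply/matrixP => i j; rewrite !mxE; ring.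
by rewrite mulmxDr -scalemxAr tproj_self// scaler0 addr0.
Qed.

(** * Stability of the lower bound *)

(** A tangent vector at x is tangent at y up to O(|y - x|), and projH
    changes by O(|y - x|) in operator norm. *)
Lemma lower_bound_near (R : realType) (m n : nat) (T : tensor R m.+2 n)
    (gamma : R) :
  symmetric_tensor T -> 0 < gamma ->
  exists2 eps : R, 0 < eps & forall x y : 'cV[R]_n,
    on_sphere x -> on_sphere y ->
    (forall v, gamma * enorm (tproj y *m v) <= enorm (projH T y *m v)) ->
    enorm (y - x) < eps ->
    forall v, tproj x *m v = v -> gamma / 2 * enorm v <= enorm (projH T x *m v).
Proof.
move=> symT g0.
have [K K0 leK] := mxO_enorm (projH_lipschitz T).
have [L L0 leL] := mxO_enorm (@tproj_lipschitz R n).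
(* The term + 1 keeps the denominator positive when T = 0. *)
have D0 : 0 < gamma * L + K + 1 by rewrite ltr_wpDl// addr_ge0// mulr_ge0// ltW.
exists (gamma / 2 / (gamma * L + K + 1)); first by rewrite !divr_gt0.
move=> x y xS yS lb; rewrite ltr_pdivlMr// => ltd v Pv.
have := leK x y xS yS v; have := leL x y xS yS v; rewrite expr1.
set d := enorm (y - x) in ltd *; set N := enorm v => leLv leKv.
have d0 : 0 <= d := enorm_ge0 _.
have N0 : 0 <= N := enorm_ge0 _.
have N1 : N <= enorm (tproj y *m v) + L * d * N.
  apply: (@le_trans _ _
    (enorm (tproj y *m v) + enorm ((tproj y - tproj x) *m v))).
    have := enormD (tproj y *m v) (- ((tproj y - tproj x) *m v)).
    have Ev : (tproj y - tproj x) *m v = tproj y *m v - v by rewrite mulmxBl Pv.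
    by rewrite enormN {1}Ev opprB addrC subrK.
  by rewrite lerD2l.
have N2 : enorm (projH T y *m v) <= enorm (projH T x *m v) + K * d * N.
  rewrite -[X in enorm (X *m v) <= _](subrK (projH T x)) addrC mulmxDl.
  by rewrite (le_trans (enormD _ _))// lerD2l.
have N3 : gamma * N <= gamma * (enorm (tproj y *m v) + L * d * N).
  by rewrite ler_pM2l.
have N4 : d * (gamma * L + K + 1) * N <= gamma / 2 * N.
  by rewrite ler_wpM2r// ltW.
have dN : 0 <= d * N by rewrite mulr_ge0.
have N5 := lb v.
move: N2 N3 N4 N5; rewrite -/N.
move: (enorm (tproj y *m v)) (enorm (projH T y *m v)) (enorm (projH T x *m v)).
move=> a b c N2 N3 N4 N5.
have N6 : d * (gamma * L + K + 1) * N =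
  gamma * (L * d * N) + K * d * N + d * N by ring.
by lra.
Qed.

Lemma coercive_unitmx (R : realType) (p : nat) (A : 'M[R]_p) (c : R) :
  0 < c -> (forall w : 'cV[R]_p, c * enorm w <= enorm (A *m w)) ->
  A \in unitmx.
Proof.
move=> c0 lb; rewrite -unitmx_tr -row_free_unit; apply: inj_row_free => v vA.
have := lb v^T; rewrite -[A *m _]trmxK trmx_mul trmxK vA trmx0 enorm0.
rewrite pmulr_rle0// => v0; apply: trmx_inj; rewrite trmx0.
by apply/eqP; rewrite -enorm_eq0 eq_le v0 enorm_ge0.
Qed.

Lemma Hp_unitmx (R : realType) (m n : nat) (U : 'cV[R]_n -> 'M[R]_(n, n.-1))
    (T : tensor R m.+2 n) (x : 'cV[R]_n) (c : R) :
  0 < c -> on_sphere x -> orthocompl_basis x (U x) ->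
  (forall v, tproj x *m v = v -> c * enorm v <= enorm (projH T x *m v)) ->
  Hp U T x \in unitmx.
Proof.
move=> c0 xS bU lb; apply: (coercive_unitmx c0) => w.
have [UU _] := bU; rewrite -(isometry_enorm w UU).
rewrite -(isometry_enorm (Hp U T x *m w) UU).
have Pv : tproj x *m (U x *m w) = U x *m w.
  rewrite -(orthocompl_basis_proj xS bU) -(mulmxA (U x)) (mulmxA (U x)^T).
  by rewrite UU mul1mx.
have := lb _ Pv; rewrite (Hp_projH T xS bU).
rewrite -(mulmxA (U x *m Hp U T x)) (mulmxA (U x)^T) UU mul1mx.
by rewrite -(mulmxA (U x)).
Qed.

(** * Error of one Newton correction *)

Lemma correction_tangent (R : realType) (m n : nat)
    (U : 'cV[R]_n -> 'M[R]_(n, n.-1)) (T : tensor R m.+2 n) (x : 'cV[R]_n) :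
  on_sphere x -> orthocompl_basis x (U x) ->
  tproj x *m oncm_correction U T x = oncm_correction U T x.
Proof.
move=> xS bU; have [UU _] := bU.
rewrite /oncm_correction mulmxN !mulmxA -(orthocompl_basis_proj xS bU).
by rewrite -(mulmxA (U x) (U x)^T (U x)) UU mulmx1.
Qed.

Lemma correction_eq (R : realType) (m n : nat)
    (U : 'cV[R]_n -> 'M[R]_(n, n.-1)) (T : tensor R m.+2 n) (x : 'cV[R]_n) :
  on_sphere x -> orthocompl_basis x (U x) -> Hp U T x \in unitmx ->
  projH T x *m oncm_correction U T x = - (tproj x *m g T x).
Proof.
move=> xS bU uH; have [UU _] := bU.
rewrite (Hp_projH T xS bU) -(orthocompl_basis_proj xS bU).
rewrite /oncm_correction; move: (Hp U T x) uH => Q uQ; rewrite mulmxN !mulmxA.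
rewrite -(mulmxA (U x *m _) (U x)^T (U x)) UU mulmx1.
by rewrite -(mulmxA (U x) Q) mulmxV// mulmx1.
Qed.

(** The tangent vector u - P d is controlled through projH by the residual;
    the rest of x + u - y is the radial component of d. *)
Lemma correction_error (R : realType) (m n : nat) (T : tensor R m.+2 n)
    (gamma : R) :
  symmetric_tensor T -> 0 < gamma ->
  exists2 C : R, 0 <= C &
    forall U : 'cV[R]_n -> 'M[R]_(n, n.-1),
    forall (x y : 'cV[R]_n) (lambda : R),
      on_sphere x -> orthocompl_basis x (U x) -> eigenpair T y lambda ->
      (forall v, tproj x *m v = v ->
         gamma / 2 * enorm v <= enorm (projH T x *m v)) ->
      enorm (x + oncm_correction U T x - y) <= C * enorm (y - x) ^+ 2.
Proof.
move=> symT g0.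
have [K K0 leK] := mxO_enorm_vec (newton_residual_quadratic symT).
have [L L0 leL] := mxO_enorm_vec (mxOZ (@sphere_dot_diff R n) (@mxO_id R n)).
have h0 : 0 < gamma / 2 by rewrite divr_gt0.
exists ((gamma / 2)^-1 * K + L).
  by rewrite addr_ge0// mulr_ge0// invr_ge0 ltW.
move=> U x y lambda xS bU eT lb; have yS : on_sphere y by case: eT.
have uH := Hp_unitmx h0 xS bU lb.
set u := oncm_correction U T x; set d := y - x.
pose e := u - tproj x *m d.
have Pe : tproj x *m e = e.
  by rewrite mulmxBr correction_tangent// mulmxA tproj_idem.
have Ae : projH T x *m e = - (tproj x *m newton_residual T x y).
  rewrite -(newton_residualE xS eT) (mulmxBr (projH T x)) correction_eq//.
  rewrite (mulmxDr _ (g T x)) opprD; congr (_ - _).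
  by rewrite /projH -!mulmxA (mulmxA (tproj x) (tproj x)) tproj_idem.
have le_e : enorm e <= (gamma / 2)^-1 * (K * enorm d ^+ 2).
  rewrite ler_pdivlMl//; apply: (le_trans (lb e Pe)).
  rewrite Ae enormN; apply: (le_trans (enorm_tproj_le _ xS)); exact: leK.
have -> : x + u - y = e - dot x d *: x.
  rewrite /e tprojE (opprB d) (addrA u) addrAC addrK /d (opprB y x).
  by rewrite (addrA u) (addrC x).
rewrite mulrDl (le_trans (enormD _ _))// enormN lerD//; last exact: leL.
by rewrite -mulrA.
Qed.

(** Normalisation moves z by | |z| - 1 |, which is at most |z - y| since
    |y| = 1. *)
Lemma normalize_error (R : realType) (n : nat) (y z : 'cV[R]_n) :
  on_sphere y -> enorm (z - y) < 1 ->
  [/\ enorm z != 0, on_sphere ((enorm z)^-1 *: z) &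
     enorm (y - (enorm z)^-1 *: z) <= 2 * enorm (z - y)].
Proof.
move=> yS lt1.
have le1 : 1 <= enorm z + enorm (z - y).
  by rewrite -yS -[in leLHS](subKr z y) (le_trans (enormD _ _))// enormN.
have le2 : enorm z <= enorm (z - y) + 1.
  by rewrite -yS -[in leLHS](subrK y z) enormD.
have z0 : 0 < enorm z by move: lt1 le1; lra.
split; first by rewrite gt_eqF.
  by rewrite /on_sphere enormZ ger0_norm ?invr_ge0 ?ltW// mulVf// gt_eqF.
have -> : y - (enorm z)^-1 *: z = (y - z) + (1 - (enorm z)^-1) *: z.
  by rewrite scalerBl scale1r addrA subrK.
rewrite (le_trans (enormD _ _))// enormB mulrDl mul1r lerD2l enormZ.
rewrite -{2}(ger0_norm (ltW z0)) -normrM mulrBl mul1r mulVf ?gt_eqF//.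
by rewrite ler_norml; move: le1 le2; lra.
Qed.

(** The product C * eps is at most 1/2 so that, on the ball, the quadratic
    estimate also halves the distance to the eigenvector. *)
Lemma oncm_step_quadratic (R : realType) (m n : nat) (T : tensor R m.+2 n)
    (gamma : R) :
  symmetric_tensor T -> 0 < gamma ->
  exists2 eps : R, 0 < eps & exists2 C : R, 0 < C & C * eps <= 2^-1 /\
    forall U : 'cV[R]_n -> 'M[R]_(n, n.-1), orthocompl_frame U ->
    forall (y : 'cV[R]_n) (lambda : R), newton_stable U T gamma y lambda ->
    forall x : 'cV[R]_n, on_sphere x -> enorm (y - x) < eps ->
      [/\ Hp U T x \in unitmx,
          enorm (x + oncm_correction U T x) != 0,
          on_sphere (oncm_step U T x) &
          enorm (y - oncm_step U T x) <= C * enorm (y - x) ^+ 2].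
Proof.
move=> symT g0.
have [eps0 eps0_gt0 near] := lower_bound_near symT g0.
have [C C0 err] := correction_error symT g0.
have C1 : 0 < 2 * (C + 1) by rewrite mulr_gt0// ltr_wpDl.
(* The last bound makes 2 (C + 1) eps at most 1/2; with eps <= 1 it also keeps
   the error of x + u below 1, so that x + u cannot vanish. *)
pose eps := Num.min (Num.min eps0 1) (2^-1 / (2 * (C + 1))).
have eps_gt0 : 0 < eps by rewrite !lt_min eps0_gt0 ltr01 divr_gt0.
exists eps => //; exists (2 * (C + 1)) => //; split.
  by rewrite mulrC -ler_pdivlMr// ge_min lexx orbT.
move=> U frU y lambda stab x xS; rewrite !lt_min => /andP[/andP[d0 d1] d2].
have yS : on_sphere y by case: stab => -[].
have eT : eigenpair T y lambda by case: stab.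
have lb := near x y xS yS
  (newton_stable_lower_bound symT (frU y yS) stab) d0.
have h0 : 0 < gamma / 2 by rewrite divr_gt0.
have le_err := err U x y lambda xS (frU x xS) eT lb.
have dge0 : 0 <= enorm (y - x) := enorm_ge0 _.
have lt1 : enorm (x + oncm_correction U T x - y) < 1.
  move: le_err d1 d2; rewrite ltr_pdivlMr//.
  set d := enorm (y - x) in dge0 *; move=> le_err d1 d2.
  apply: (le_lt_trans le_err); nra.
have [z0 zS zle] := normalize_error yS lt1.
split => //; first exact: (Hp_unitmx h0 xS (frU x xS) lb).
apply: (le_trans zle); rewrite -mulrA ler_pM2l//; apply: (le_trans le_err).
by rewrite ler_wpM2r ?sqr_ge0// lerDl.
Qed.

(** * Convergence of the iteration *)

(** Transfers Euclidean estimates to the sup norm, which defines the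
    topology of column vectors. *)
Lemma normr_le_enorm (R : realType) (n : nat) (x : 'cV[R]_n) :
  `|x| <= enorm x.
Proof.
rewrite /Num.norm/=.
have [->|/mx_norm_neq0[[i j] ->]/=] := eqVneq (mx_norm x) 0.
  exact: enorm_ge0.
by rewrite (ord1 j); exact: coord_le_enorm.
Qed.

Lemma cvg_enorm_geometric (R : realType) (n : nat) (x : nat -> 'cV[R]_n)
    (l : 'cV[R]_n) (a q : R) :
  `|q| < 1 -> (forall k, enorm (l - x k) <= a * q ^+ k) ->
  (x @ \oo --> l)%classic.
Proof.
move=> q1 le_x; apply/cvgrPdist_lt => e e0.
have /cvgrPdist_lt/(_ e e0) := cvg_geometric a q1.
apply: filterS => k; rewrite sub0r normrN => lt_e.
apply: (le_lt_trans (normr_le_enorm _)); apply: (le_lt_trans (le_x k)).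
by apply: le_lt_trans lt_e; rewrite ler_norm.
Qed.

Theorem theorem2 (R : realType) (m n : nat) (T : tensor R m.+2 n)
    (T_sym : symmetric_tensor T) (gamma : R) (gamma_gt0 : 0 < gamma) :
  exists2 eps : R, 0 < eps &
    forall U : 'cV[R]_n -> 'M[R]_(n, n.-1), orthocompl_frame U ->
    forall (xs : 'cV[R]_n) (lambda : R), newton_stable U T gamma xs lambda ->
    forall x0 : 'cV[R]_n, on_sphere x0 -> enorm (x0 - xs) < eps ->
      oncm_well_defined U T x0 /\ quadratic_cvg (oncm U T x0) xs.
Proof.
have [eps eps0 [C C0 [Ceps step]]] := oncm_step_quadratic T_sym gamma_gt0.
exists eps => // U frU xs lambda stab x0 x0S; rewrite enormB => lt0.
have shrink k : enorm (xs - x0) * 2^-1 ^+ k <= enorm (xs - x0).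
  by rewrite ler_piMr ?enorm_ge0// exprn_ile1// ?invr_ge0// invf_le1// ler1n.
have inv k : on_sphere (oncm U T x0 k) /\
    enorm (xs - oncm U T x0 k) <= enorm (xs - x0) * 2^-1 ^+ k.
  elim: k => [|k [xkS le_k]]; first by rewrite expr0 mulr1.
  have ltk : enorm (xs - oncm U T x0 k) < eps.
    by apply: le_lt_trans lt0; apply: le_trans le_k _.
  have [_ _ xSS leS] := step U frU xs lambda stab _ xkS ltk.
  split; first by rewrite /oncm iterS.
  rewrite /oncm iterS exprSr mulrA; apply: (le_trans leS).
  rewrite expr2 mulrA mulrC ler_pM ?mulr_ge0 ?enorm_ge0 ?(ltW C0)//.
  by apply: le_trans Ceps; rewrite ler_pM2l// ltW.
have near k : enorm (xs - oncm U T x0 k) < eps.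
  by apply: le_lt_trans lt0; apply: le_trans (proj2 (inv k)) _.
split.
  by move=> k; have [] := step U frU xs lambda stab _ (proj1 (inv k)) (near k).
split.
  apply: (@cvg_enorm_geometric _ _ _ _ (enorm (xs - x0)) 2^-1).
    by rewrite ger0_norm ?invr_ge0// invf_lt1// ltr1n.
  by move=> k; exact: (proj2 (inv k)).
exists C => // k; rewrite {1}/oncm iterS.
by have [] := step U frU xs lambda stab _ (proj1 (inv k)) (near k).
Qed.
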